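(* For each $n\ge1$ there exists a constant $K_n>0$ depending only on $n$ such that the following holds. Let $f,g\colon\mathbb{R}^n\to\mathbb{R}$ be convex continuous functions with $\mathcal{C}_f=\arg\min f\neq\emptyset$, let $r>0$ and $\mathcal{U}_r:=\{x\in\mathbb{R}^n: d(x,\mathcal{C}_f)\le r\}$. Then for every $x\in\mathcal{U}_r$, $$g(x)-f(x)\;\le\;K_n\,\|s_g-s_f|_{\mathcal{U}_r}\,d(x,\mathcal{C}_f)\;+\;\|g-f|_{\mathcal{C}_f}.$$
   Context: $\partial f(x)=\{v: f(y)-f(x)\ge\langle v,y-x\rangle\ \forall y\}$ is the convex subdifferential and $s_f(x):=\operatorname{dist}(0,\partial f(x))$ is the slope (similarly for $g$). $d(x,\mathcal{C})$ is the Euclidean distance from $x$ to $\mathcal{C}$. For $\omega\colon\mathbb{R}^n\to\mathbb{R}$ and $\mathcal{U}\subset\mathbb{R}^n$, $\|\omega|_{\mathcal{U}}:=\sup_{x\in\mathcal{U}}\max\{\omega(x),0\}$. *)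

(* Defs.v *)
From HB Require Import structures.
From mathcomp Require Import all_boot all_order all_algebra.
From mathcomp Require Import all_classical all_reals all_analysis.
Set Implicit Arguments.
Unset Strict Implicit.
Unset Printing Implicit Defensive.
Import Order.TTheory GRing.Theory Num.Theory.
Import numFieldNormedType.Exports.
Local Open Scope classical_set_scope.
Local Open Scope ring_scope.

Section Defs.
Variables (R : realType) (n : nat).
Notation V := 'rV[R]_n.

Definition dotp (u v : V) : R := \sum_(i < n) u ord0 i * v ord0 i.
Definition enorm (u : V) : R := Num.sqrt (dotp u u).

Definition convex_fun (f : V -> R) : Prop :=
  forall (x y : V) (t : R), 0 <= t -> t <= 1 ->
    f (t *: x + (1 - t) *: y) <= t * f x + (1 - t) * f y.

Definition argmin (f : V -> R) : set V := [set x | forall y, f x <= f y].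

Definition subdiff (f : V -> R) (x : V) : set V :=
  [set v | forall y, dotp v (y - x) <= f y - f x].

Definition slope (f : V -> R) (x : V) : R :=
  inf [set enorm v | v in subdiff f x].

Definition dist_set (x : V) (C : set V) : R :=
  inf [set enorm (x - y) | y in C].

Definition possup (w : V -> R) (U : set V) : \bar R :=
  ereal_sup [set (Num.max (w x) 0)%:E | x in U].

End Defs.

(* Main.v *)
Require Import Defs.
From HB Require Import structures.
From mathcomp Require Import all_boot all_order all_algebra.
From mathcomp Require Import all_classical all_reals all_analysis.
From mathcomp Require Import ring lra.
Set Implicit Arguments.
Unset Strict Implicit.
Unset Printing Implicit Defensive.
Import Order.TTheory GRing.Theory Num.Theory.
Import numFieldNormedType.Exports.
Local Open Scope classical_set_scope.
Local Open Scope ring_scope.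

(* The gap [g - f] is followed along proximal steps x_{k+1} of [f] with parameter
   [lam], in place of the gradient flow of [f].  The vector
   (x_k - x_{k+1}) / lam is a subgradient of [f] at x_{k+1} whose norm lies
   between the slopes of [f] at x_{k+1} and x_k, so a step decreases [g - f] by at
   most sup (s_g - s_f) times its length, up to an error that telescopes to
   O(lam).  Proximal sequences are self-contracted, and in dimension n such a
   sequence has length at most K_n times its diameter: the directions from one
   point to the later ones form pairwise non-obtuse angles, hence all have
   positive product with one element of a finite set of vectors depending only on
   n.  The sequence clusters in argmin f; let lam tend to 0. *)

(** * Euclidean norm on row vectors: comparison with the sup norm, compactness, finite nets *)

Section Euclidean.
Variables (R : realType) (n : nat).
Implicit Types (u v w x y : 'rV[R]_n) (a e : R).

Lemma dotpC u v : dotp u v = dotp v u.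
Proof. by apply: eq_bigr => i _; rewrite mulrC. Qed.

Lemma dotpDl u v w : dotp (u + v) w = dotp u w + dotp v w.
Proof. by rewrite -big_split; apply: eq_bigr => i _; rewrite mxE mulrDl. Qed.

Lemma dotpZl a u w : dotp (a *: u) w = a * dotp u w.
Proof. by rewrite mulr_sumr; apply: eq_bigr => i _; rewrite mxE mulrA. Qed.

Lemma dotpNl u w : dotp (- u) w = - dotp u w.
Proof. by rewrite -scaleN1r dotpZl mulN1r. Qed.

Lemma dotpDr u v w : dotp w (u + v) = dotp w u + dotp w v.
Proof. by rewrite !(dotpC w) dotpDl. Qed.

Lemma dotpZr a u w : dotp w (a *: u) = a * dotp w u.
Proof. by rewrite !(dotpC w) dotpZl. Qed.

Lemma dotpNr u w : dotp w (- u) = - dotp w u.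
Proof. by rewrite !(dotpC w) dotpNl. Qed.

Lemma dot0p w : dotp 0 w = 0.
Proof. by rewrite -(scale0r 0) dotpZl mul0r. Qed.

Lemma dotp_suml (I : finType) (F : I -> 'rV[R]_n) w :
  dotp (\sum_i F i) w = \sum_i dotp (F i) w.
Proof.
elim/big_rec2: _ => [|i a u _ <-]; first exact: dot0p.
exact: dotpDl.
Qed.

Definition dotpE := (dotpDl, dotpDr, dotpNl, dotpNr, dotpZl, dotpZr).

Lemma dotp_ge0 u : 0 <= dotp u u.
Proof. by apply: sumr_ge0 => i _; rewrite -expr2 sqr_ge0. Qed.

Lemma enorm_ge0 u : 0 <= enorm u.
Proof. exact: sqrtr_ge0. Qed.

Lemma sqr_enorm u : enorm u ^+ 2 = dotp u u.
Proof. by rewrite sqr_sqrtr// dotp_ge0. Qed.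

Lemma enormZ a u : enorm (a *: u) = `|a| * enorm u.
Proof. by rewrite /enorm dotpZl dotpZr mulrA -expr2 sqrtrM ?sqr_ge0// sqrtr_sqr. Qed.

Lemma enormN u : enorm (- u) = enorm u.
Proof. by rewrite -scaleN1r enormZ normrN1 mul1r. Qed.

Lemma enorm0 : enorm (0 : 'rV[R]_n) = 0.
Proof. by rewrite /enorm dot0p sqrtr0. Qed.

Lemma enormBC u v : enorm (u - v) = enorm (v - u).
Proof. by rewrite -enormN opprB. Qed.

Lemma norm_coord_le_enorm u i : `|u ord0 i| <= enorm u.
Proof.
rewrite -sqrtr_sqr ler_wsqrtr// /dotp (bigD1 i)//= -expr2 lerDl.
by apply: sumr_ge0 => j _; rewrite -expr2 sqr_ge0.
Qed.

Lemma enorm_eq0 u : enorm u = 0 -> u = 0.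
Proof.
move=> u0; apply/rowP => i; rewrite mxE; apply/eqP.
by rewrite -normr_le0 -u0 norm_coord_le_enorm.
Qed.

Lemma dotp_le_enorm u v : dotp u v <= enorm u * enorm v.
Proof.
have [/enorm_eq0->|u0] := eqVneq (enorm u) 0.
  by rewrite dot0p enorm0 mul0r.
have [/enorm_eq0->|v0] := eqVneq (enorm v) 0.
  by rewrite dotpC dot0p enorm0 mulr0.
have := dotp_ge0 (enorm v *: u - enorm u *: v).
have -> : dotp (enorm v *: u - enorm u *: v) (enorm v *: u - enorm u *: v) =
    2 * (enorm u * enorm v) * (enorm u * enorm v - dotp u v).
  by rewrite !dotpE (dotpC v u) -!sqr_enorm; ring.
by rewrite pmulr_rge0 ?subr_ge0// !mulr_gt0// lt_def (u0, v0) enorm_ge0.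
Qed.

Lemma enormD_le u v : enorm (u + v) <= enorm u + enorm v.
Proof.
rewrite -(@ler_pXn2r _ 2)// ?nnegrE ?addr_ge0 ?enorm_ge0//.
rewrite sqr_enorm !dotpE (dotpC v u) sqrrD -!sqr_enorm.
by have := dotp_le_enorm u v; lra.
Qed.

Lemma enormB_le w u v : enorm (u - v) <= enorm (u - w) + enorm (w - v).
Proof. by rewrite -[leLHS](_ : enorm (u - w + (w - v)) = _) ?enormD_le// subrKA. Qed.

Lemma enorm_sum_le (I : finType) (F : I -> 'rV[R]_n) :
  enorm (\sum_i F i) <= \sum_i enorm (F i).
Proof.
elim/big_rec2: _ => [|i a u _ h]; first by rewrite enorm0.
by rewrite (le_trans (enormD_le _ _))// lerD2l.
Qed.

Lemma enorm_le_l1 u : enorm u <= \sum_i `|u ord0 i|.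
Proof.
have s0 : 0 <= \sum_i `|u ord0 i| by apply: sumr_ge0.
rewrite -[leRHS]ger0_norm// -sqrtr_sqr ler_wsqrtr// expr2 mulr_suml.
apply: ler_sum => i _; rewrite (le_trans (ler_norm _))// normrM ler_wpM2l//.
by rewrite (bigD1 i)//= lerDl sumr_ge0.
Qed.

(** The topology on row vectors comes from the sup norm [|u|]; this bound and the next transfer
    boundedness, continuity and clustering to [enorm]. *)
Lemma normv_le_enorm u : `|u| <= enorm u.
Proof.
rewrite [leLHS]/Num.Def.normr/= mx_normrE; apply/bigmax_leP.
by split=> [|[i j] _ /=]; rewrite ?enorm_ge0// ord1 norm_coord_le_enorm.
Qed.

Lemma enorm_le_normv u : enorm u <= n%:R * `|u|.
Proof.
apply: le_trans (enorm_le_l1 u) _.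
rewrite -[n in n%:R]card_ord mulr_natl -sumr_const ler_sum// => i _.
rewrite [leRHS]/Num.Def.normr/= mx_normrE; apply/bigmax_geP; right => /=.
by exists (ord0, i).
Qed.

Lemma sqr_enormB_continuous x : continuous (fun y => enorm (y - x) ^+ 2).
Proof.
have -> : (fun y => enorm (y - x) ^+ 2) =
    fun y => \sum_(i < n) (y ord0 i - x ord0 i) * (y ord0 i - x ord0 i).
  by apply/funext => y; rewrite sqr_enorm; apply: eq_bigr => i _; rewrite !mxE.
apply: (@continuous_big R _ +%R 0 xpredT) => [|i _ y]; first exact: add_continuous.
have c : continuous (fun z : 'rV[R]_n => z ord0 i - x ord0 i).
  move=> z; apply: (@continuousB _ _ _ (fun z : 'rV[R]_n => z ord0 i)).
    exact: coord_continuous.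
  exact: cst_continuous.
exact: (continuousM (c y) (c y)).
Qed.

Definition eball x e : set 'rV[R]_n := [set y | enorm (y - x) <= e].

Lemma eball_compact x e : compact (eball x e).
Proof.
have [e0|e0] := ltP e 0.
  rewrite (_ : eball x e = set0); first exact: compact0.
  apply/seteqP; split=> // y /=; rewrite /eball/= => h.
  by have := le_lt_trans h e0; rewrite ltNge enorm_ge0.
apply: bounded_closed_compact.
  exists (enorm x + e); split; first exact: num_real.
  move=> M /ltW hM y /= yx; apply: le_trans (normv_le_enorm y) (le_trans _ hM).
  by rewrite -(subrK x y) (le_trans (enormD_le _ _))// addrC lerD2l.
rewrite (_ : eball x e = (fun y => enorm (y - x) ^+ 2) @^-1` [set z | z <= e ^+ 2]).
  by apply: closed_comp; [move=> ? _; exact: sqr_enormB_continuous|exact: closed_le].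
by apply/seteqP; split=> y /=; rewrite ler_pXn2r// nnegrE enorm_ge0.
Qed.

Lemma eball_min (f : 'rV[R]_n -> R) x e : continuous f -> 0 <= e ->
  exists2 p, eball x e p & forall y, eball x e y -> f p <= f y.
Proof.
move=> cf e0; have [||c] := @EVT_min_rV R n f (eball x e) _ (@eball_compact x e).
- by exists x; rewrite /eball/= subrr enorm0.
- exact: continuous_subspaceT.
- by rewrite inE => cA h; exists c => // y yA; apply: h; rewrite inE.
Qed.

Lemma eball_max (f : 'rV[R]_n -> R) x e : continuous f -> 0 <= e ->
  exists2 p, eball x e p & forall y, eball x e y -> f y <= f p.
Proof.
move=> cf e0; have [||c] := @EVT_max_rV R n f (eball x e) _ (@eball_compact x e).
- by exists x; rewrite /eball/= subrr enorm0.
- exact: continuous_subspaceT.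
- by rewrite inE => cA h; exists c => // y yA; apply: h; rewrite inE.
Qed.

Lemma continuous_enormP (f : 'rV[R]_n -> R) x e : continuous f -> 0 < e ->
  exists2 d, 0 < d & forall y, enorm (y - x) < d -> `|f y - f x| < e.
Proof.
move=> cf e0; have /cvgrPdist_lt/(_ e e0)/nbhs_ballP[d /= d0 hd] := cf x.
exists d => // y yx; rewrite distrC; apply: hd.
rewrite -ball_normE /ball_/= distrC.
exact: le_lt_trans (normv_le_enorm _) yx.
Qed.

Lemma bounded_seq_cluster (s : nat -> 'rV[R]_n) x a :
  (forall k, enorm (s k - x) <= a) ->
  exists l, forall e N, 0 < e -> exists2 k, (N <= k)%N & enorm (s k - l) < e.
Proof.
move=> sa; have [|l [_ cl]] := @eball_compact x a (s @ \oo) _.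
  by exists 0%N => // k _ /=; exact: sa.
exists l => e N e0; pose d := e / n.+1%:R.
have d0 : 0 < d by rewrite divr_gt0.
have [||y [[k Nk <-] ly]] := cl (s @` [set k | (N <= k)%N]) (ball l d).
- by exists N => // k /= Nk; exists k.
- exact: nbhsx_ballx.
exists k => //; apply: le_lt_trans (enorm_le_normv _) _.
move: ly; rewrite -ball_normE /ball_/= distrC => h.
apply: (@le_lt_trans _ _ (n.+1%:R * `|s k - l|)).
  by rewrite ler_wpM2r// ler_nat.
by rewrite -ltr_pdivlMl// mulrC.
Qed.

(** Round each coordinate down on a grid of mesh [h], with h = e / (n + 1), over the cube [-a, a]^n;
    the l1 error is at most n h <= e. *)
Lemma finite_net (a e : R) : 0 < e -> exists (T : finType) (phi : T -> 'rV[R]_n),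
  forall w, enorm w <= a -> exists t, enorm (w - phi t) <= e.
Proof.
move=> e0; pose h := e / n.+1%:R; have h0 : 0 < h by rewrite divr_gt0.
pose m := Num.truncn ((a + a) / h).
exists {ffun 'I_n -> 'I_m.+1}.
exists (fun t : {ffun 'I_n -> 'I_m.+1} => \row_i ((t i : nat)%:R * h - a)) => w wa.
exists [ffun i => inord (Num.truncn ((w ord0 i + a) / h))].
apply: le_trans (enorm_le_l1 _) _.
apply: (@le_trans _ _ (\sum_(i < n) h)); last first.
  rewrite sumr_const card_ord -mulr_natl /h mulrCA ger_pMr// ler_pdivrMr//.
  by rewrite mul1r ler_nat.
apply: ler_sum => i _; rewrite !mxE ffunE.
have := le_trans (norm_coord_le_enorm w i) wa; rewrite ler_norml => /andP[wl wr].
have wh0 : 0 <= (w ord0 i + a) / h by rewrite divr_ge0 ?(ltW h0)//; lra.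
rewrite inordK; last first.
  by rewrite ltnS le_truncn// ler_wpM2r ?invr_ge0 ?(ltW h0)//; lra.
have /andP[] := truncn_itv wh0; move: (Num.truncn _) => k.
rewrite ler_pdivlMr// ltr_pdivrMr// -natr1 mulrDl mul1r => h1 h2.
rewrite ler_norml; apply/andP; split; lra.
Qed.

End Euclidean.

(** * Length of bounded self-contracted sequences *)

Section SelfContracted.
Variables (R : realType) (n : nat).

(* A direction [u] almost in the dual cone is the sum of one representative of
   [D] in each cell of a finite net that [D] meets: its product with [d] is at
   least the contribution of the cell of [d].  Rounding [u] to a second net
   makes the choice range over a finite type independent of [D]. *)
Lemma finite_dual_directions :
  exists (T : finType) (phi : T -> 'rV[R]_n), forall D : set 'rV[R]_n,
    (forall d, D d -> enorm d = 1) ->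
    (forall d d', D d -> D d' -> 0 <= dotp d d') ->
    exists t, forall d, D d -> 4^-1 <= dotp (phi t) d.
Proof.
(* Vectors of one cell lie within 1 of each other, so unit vectors there have product at least 1/2;
   rounding in the second net costs at most 1/4. *)
have [T1 [phi1 net1]] := @finite_net R n 1 (2^-1) ltac:(lra).
have [T2 [phi2 net2]] := @finite_net R n #|T1|%:R (4^-1) ltac:(lra).
exists T2, phi2 => D D1 D0.
pose rep t := xget 0 [set d | D d /\ enorm (d - phi1 t) <= 2^-1].
have repP t : rep t = 0 \/ (D (rep t) /\ enorm (rep t - phi1 t) <= 2^-1).
  by rewrite /rep; case: xgetP; [right|left].
have [|t ut] := net2 (\sum_t rep t).
  apply: le_trans (enorm_sum_le _) _; rewrite -sum1_card natr_sum ler_sum// => t _.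
  by case: (repP t) => [->|[/D1->]]; rewrite ?enorm0.
exists t => d Dd.
have [|s ds] := net1 d; first by rewrite D1.
have [Ds es] : D (rep s) /\ enorm (rep s - phi1 s) <= 2^-1.
  by rewrite /rep; case: xgetP => // /(_ d); case.
have rsd : 2^-1 <= dotp (rep s) d.
  have : enorm (rep s - d) <= 1.
    by apply: le_trans (enormB_le (phi1 s) _ _) _; rewrite (enormBC (phi1 s)); lra.
  rewrite -[_ <= 1](@ler_pXn2r _ 2)// ?nnegrE ?enorm_ge0// sqr_enorm !dotpE (dotpC d).
  by rewrite -!sqr_enorm !D1//; lra.
have : 2^-1 <= dotp (\sum_t rep t) d.
  rewrite dotp_suml (bigD1 s)//= (le_trans rsd)// lerDl sumr_ge0// => r _.
  by case: (repP r) => [->|[Dr _]]; rewrite ?dot0p ?D0.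
have := dotp_le_enorm (\sum_t rep t - phi2 t) d.
by rewrite (D1 d)// mulr1 !dotpE; lra.
Qed.

(* For each direction [phi t], the infimum of [dotp (phi t)] over the tail
   [x i, x i.+1, ...] is nondecreasing in [i], and at each [i] some [t] sees it
   increase by a fixed fraction of the [i]-th step. *)
Lemma self_contracted_length : exists2 K : R, 0 < K &
  forall (x : nat -> 'rV[R]_n) (D : R),
    (forall i j k, (i <= j <= k)%N -> enorm (x j - x k) <= enorm (x i - x k)) ->
    (forall i, enorm (x i - x 0%N) <= D) ->
    forall N, \sum_(i < N) enorm (x i.+1 - x i) <= K * D.
Proof.
have [T [phi dual]] := finite_dual_directions.
have S0 : 0 <= \sum_t enorm (phi t) by apply: sumr_ge0 => t _; exact: enorm_ge0.
(* A step forces a total rise of at least 1/8 of its length, and each infimum rises by at most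
   [enorm (phi t) * (2 * D)] overall; hence 16. The [+ 1] keeps the constant positive when all
   [phi t] vanish. *)
exists (16 * \sum_t enorm (phi t) + 1); first lra.
move=> x D sc xD N.
have D0 : 0 <= D by rewrite (le_trans _ (xD 0%N))// enorm_ge0.
pose A t i := [set dotp (phi t) (x j) | j in [set j | (i <= j)%N]].
have bnd t j : `|dotp (phi t) (x j - x 0%N)| <= enorm (phi t) * D.
  have h u : dotp u (x j - x 0%N) <= enorm u * D.
    by apply: le_trans (dotp_le_enorm _ _) _; rewrite ler_wpM2l ?enorm_ge0.
  by rewrite ler_norml lerNl -dotpNl h andbT -[in leRHS]enormN h.
have lb t i : lbound (A t i) (dotp (phi t) (x 0%N) - enorm (phi t) * D).
  move=> _ [j _ <-]; have := bnd t j.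
  by rewrite ler_norml !dotpE => /andP[]; lra.
have An t i : A t i !=set0 by exists (dotp (phi t) (x i)), i => /=.
pose m t i := inf (A t i).
have m_le t i j : (i <= j)%N -> m t i <= dotp (phi t) (x j).
  move=> ij; apply: ge_inf; last by exists j.
  by exists (dotp (phi t) (x 0%N) - enorm (phi t) * D).
have m_homo t i : m t i <= m t i.+1.
  by apply: lb_le_inf => // _ [j ij <-]; apply: m_le; exact: ltnW.
have step i : 8^-1 * enorm (x i.+1 - x i) <= \sum_t m t i.+1 - \sum_t m t i.
  rewrite -sumrB.
  have [->|xi] := eqVneq (enorm (x i.+1 - x i)) 0.
    by rewrite mulr0 sumr_ge0// => t _; rewrite subr_ge0.
  (* Triangle inequality through [x j], since [x i.+1] is no farther from [x j] than [x i] is. *)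
  have xj j : (i < j)%N -> 2^-1 * enorm (x i.+1 - x i) <= enorm (x j - x i).
    move=> ij; have := sc i i.+1 j; rewrite leqnSn ij => /(_ isT).
    have := enormB_le (x j) (x i.+1) (x i).
    by rewrite (enormBC (x i) (x j)); lra.
  have xi0 : 0 < enorm (x i.+1 - x i) by rewrite lt_def xi enorm_ge0.
  have xj0 j : (i < j)%N -> 0 < enorm (x j - x i).
    by move=> /xj; apply: lt_le_trans; rewrite mulr_gt0.
  (* With u = x j - x i and v = x k - x i, the bound |u - v| <= |v| gives 2 <u, v> >= |u|^2. *)
  have dot0 j k : (i < j <= k)%N -> 0 <= dotp (x j - x i) (x k - x i).
    move=> /andP[ij jk]; have := sc i j k; rewrite (ltnW ij) jk => /(_ isT).
    rewrite -[enorm _ <= _](@ler_pXn2r _ 2)// ?nnegrE ?enorm_ge0// !sqr_enorm.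
    have -> : x j - x k = (x j - x i) - (x k - x i) by rewrite opprB addrA subrK.
    rewrite -(opprB (x k) (x i)); move: (x j - x i) (x k - x i) => u v.
    by rewrite !dotpE (dotpC v u); have := dotp_ge0 u; lra.
  pose dir := [set (enorm (x j - x i))^-1 *: (x j - x i) | j in [set j | (i < j)%N]].
  have [||t ht] := dual dir.
  - move=> _ [j /xj0 j0 <-]; rewrite enormZ gtr0_norm ?invr_gt0//.
    by rewrite mulVf// gt_eqF.
  - move=> _ _ [j ij <-] [k ik <-]; rewrite dotpZl dotpZr.
    rewrite !mulr_ge0 ?invr_ge0 ?enorm_ge0//=.
    move: ij ik => /= ij ik; case: (leqP j k) => jk; last rewrite dotpC.
      by apply: dot0; rewrite ij.
    by apply: dot0; rewrite ik ltnW.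
  rewrite (bigD1 t)//= -[leLHS]addr0 lerD//; last first.
    by rewrite sumr_ge0// => s _; rewrite subr_ge0.
  rewrite lerBrDl; apply: lb_le_inf => // _ [j ij <-].
  have /ht : dir ((enorm (x j - x i))^-1 *: (x j - x i)) by exists j.
  rewrite dotpZr ler_pdivlMl ?xj0// dotpDr dotpNr.
  by have := xj j ij; have := m_le t i i (leqnn i); lra.
have {step} : 8^-1 * \sum_(i < N) enorm (x i.+1 - x i) <= \sum_t m t N - \sum_t m t 0%N.
  elim: N => [|N IH]; first by rewrite big_ord0 mulr0 subrr.
  by rewrite big_ord_recr/= mulrDr; have := step N; lra.
rewrite -sumrB.
have : \sum_t (m t N - m t 0%N) <= \sum_t (enorm (phi t) * (2 * D)).
  apply: ler_sum => t _.
  have := m_le t N N (leqnn N); have := lb_le_inf (An t 0%N) (lb t 0%N).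
  have := bnd t N; rewrite ler_norml !dotpE => /andP[_].
  by rewrite -/(m t 0%N); lra.
by rewrite -mulr_suml mulrDl mul1r; lra.
Qed.

End SelfContracted.

(** * Existence of subgradients, proximal steps, and the slope *)

Section Subgradients.
Variables (R : realType) (n : nat).
Implicit Types (f g : 'rV[R]_n -> R) (x y p v w : 'rV[R]_n).

(** Stands in for the limit t -> 0: if a > 0, then t = a / (2 (c + a)) gives t c < a. *)
Lemma le0_of_le_small (a c : R) :
  0 <= c -> (forall t, 0 < t -> t <= 1 -> a <= t * c) -> a <= 0.
Proof.
move=> c0 h; rewrite leNgt; apply/negP => a0.
have ac0 : 0 < c + a by lra.
have := h (2^-1 * (a / (c + a))).
have ac1 : a / (c + a) * (c + a) = a by rewrite divfK// gt_eqF.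
have q0 : 0 < a / (c + a) by rewrite divr_gt0.
have q1 : a / (c + a) <= 1 by rewrite ler_pdivrMr//; lra.
move: (a / (c + a)) ac1 q0 q1 => q ac1 q0 q1 /(_ ltac:(lra) ltac:(lra)).
by have := mulr_gt0 q0 a0; lra.
Qed.

Lemma proximal_objective_continuous f x (a : R) :
  continuous f -> continuous (fun y => f y + enorm (y - x) ^+ 2 / a).
Proof.
move=> cf y; have cx := @sqr_enormB_continuous R n x y.
have cM := continuousM cx (@cst_continuous _ _ a^-1 y).
exact: (continuousD (cf y) cM).
Qed.

(** Compare [p] with t y + (1 - t) p, divide by t and let t tend to 0; the term in |y - p|^2 keeps a
    factor t. [A] is a ball for the existence of subgradients and the whole space for proximal
    steps. *)
Lemma proximal_optimality f (A : set 'rV[R]_n) x p (lam : R) :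
  convex_fun f -> 0 < lam ->
  (forall y (t : R), A y -> 0 <= t -> t <= 1 -> A (t *: y + (1 - t) *: p)) ->
  (forall y, A y -> f p + enorm (p - x) ^+ 2 / (2 * lam)
                    <= f y + enorm (y - x) ^+ 2 / (2 * lam)) ->
  forall y, A y -> dotp (lam^-1 *: (x - p)) (y - p) <= f y - f p.
Proof.
move=> cf l0 Aconv pmin y Ay; rewrite -subr_le0.
pose c := (2 * lam)^-1 * dotp (y - p) (y - p).
have l2 : 0 < (2 * lam)^-1 by rewrite invr_gt0; lra.
have c0 : 0 <= c by rewrite mulr_ge0 ?dotp_ge0// ltW.
apply: (le0_of_le_small c0) => t t0 t1.
have := pmin _ (Aconv y t Ay (ltW t0) t1); have := cf y p t (ltW t0) t1.
have -> : t *: y + (1 - t) *: p - x = t *: (y - p) - (x - p).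
  by apply/rowP => i; rewrite !mxE; ring.
rewrite -(opprB x p) enormN !sqr_enorm /c.
have -> : lam^-1 = 2 * (2 * lam)^-1 by field; rewrite gt_eqF.
move: (2 * lam)^-1 l2 (f (_ + _)) => k k0 fz; move: (x - p) (y - p) => u w.
rewrite !dotpE (dotpC w u) => h1 h2.
by rewrite -(ler_pM2l t0); lra.
Qed.

(** Minimizing g(y) + |y - x|^2 / (2 lam) over the unit ball around [x] gives approximate
    subgradients (x - p) / lam, bounded by the oscillation of [g] there; a cluster point as lam -> 0
    is a subgradient. *)
Lemma subdiff_nonempty g x : convex_fun g -> continuous g -> subdiff g x !=set0.
Proof.
move=> cg ctg.
(* The unit ball suffices: moving from [x] towards [y] by the fraction 1 / (1 + |y - x|) stays in
   it, and convexity carries the inequality to [y]. *)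
suff [v hv] : exists v, forall y, eball x 1 y -> dotp v (y - x) <= g y - g x.
  exists v => y; set t : R := (1 + enorm (y - x))^-1.
  have yx0 := enorm_ge0 (y - x).
  have t0 : 0 < t by rewrite invr_gt0; lra.
  have t1 : t <= 1 by rewrite invf_le1; lra.
  have zx : t *: y + (1 - t) *: x - x = t *: (y - x).
    by apply/rowP => i; rewrite !mxE; ring.
  have := cg y x t (ltW t0) t1; have := hv (t *: y + (1 - t) *: x).
  rewrite /eball/= zx enormZ gtr0_norm// dotpZr mulrC ler_pdivrMr; last lra.
  move=> /(_ ltac:(lra)) h1 h2.
  by rewrite -(ler_pM2l t0); lra.
have [pm _ pmP] := @eball_min R n g x 1 ctg ltac:(lra).
have [pM _ pMP] := @eball_max R n g x 1 ctg ltac:(lra).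
have x1 : eball x 1 x by rewrite /eball/= subrr enorm0.
pose B := g pM - g pm.
have approx (lam : R) : 0 < lam -> exists2 v, enorm v <= B &
    forall y, eball x 1 y -> dotp v (y - x) <= g y - g (x - lam *: v).
  move=> l0.
  have [|p px pP] := @eball_min R n
    (fun y => g y + enorm (y - x) ^+ 2 / (2 * lam)) x 1 _ ltac:(lra).
    exact: proximal_objective_continuous.
  have opt := @proximal_optimality g (eball x 1) x p lam cg l0 _ pP.
  pose v := lam^-1 *: (x - p); have pE : p = x - lam *: v.
    by rewrite scalerA mulfV ?gt_eqF// scale1r opprB addrC subrK.
  have {}opt y : eball x 1 y -> dotp v (y - x) <= g y - g p.
    move=> yA; apply: le_trans (opt _ _ yA); last first.
      move=> z t zx t0 t1; rewrite /eball/=.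
      have -> : t *: z + (1 - t) *: p - x = t *: (z - x) + (1 - t) *: (p - x).
        by apply/rowP => i; rewrite !mxE; ring.
      apply: le_trans (enormD_le _ _) _; rewrite !enormZ !ger0_norm ?subr_ge0//.
      have := ler_wpM2l t0 zx; have t1' : 0 <= 1 - t by lra.
      by have := ler_wpM2l t1' px; lra.
    rewrite -/v pE; have -> : y - (x - lam *: v) = (y - x) + lam *: v.
      by rewrite opprB addrA addrAC.
    by rewrite (dotpDr (y - x)) dotpZr lerDl mulr_ge0 ?dotp_ge0// ltW.
  exists v => [|y yA]; last by rewrite -pE; exact: opt.
  have [->|v0] := eqVneq (enorm v) 0.
    by rewrite subr_ge0; exact: le_trans (pmP _ x1) (pMP _ x1).
  have yA : eball x 1 (x + (enorm v)^-1 *: v).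
    rewrite /eball/= addrAC subrr add0r enormZ ger0_norm ?invr_ge0 ?enorm_ge0//.
    by rewrite mulVf.
  have := opt _ yA; rewrite addrAC subrr add0r dotpZr -sqr_enorm.
  rewrite expr2 mulKf// => /le_trans; apply.
  by apply: lerB; [exact: pMP|exact: pmP].
have lam0 (k : nat) : 0 < (k.+1%:R^-1 : R) by rewrite invr_gt0.
have /choice[v vP] : forall k : nat, exists v, enorm v <= B /\
    forall y, eball x 1 y -> dotp v (y - x) <= g y - g (x - k.+1%:R^-1 *: v).
  by move=> k; have [v ? ?] := approx _ (lam0 k); exists v.
have [|l lP] := @bounded_seq_cluster R n v 0 B.
  by move=> k; rewrite subr0; case: (vP k).
exists l => y yA; apply/ler_addgt0Pr => e e0.
have e2 : 0 < e / 2 by lra.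
have [d d0 dP] := @continuous_enormP R n g x _ ctg e2.
(* From this index on, [B / k.+1%:R] is less than [d], so the shifted base point lies within [d] of
   [x]. *)
have [k Nk kl] := lP _ (Num.truncn (B / d)) e2.
have [vB /(_ _ yA) vy] := vP k.
have /dP : enorm (x - k.+1%:R^-1 *: v k - x) < d.
  rewrite addrAC subrr add0r enormN enormZ gtr0_norm// ltr_pdivrMl//.
  rewrite -ltr_pdivrMr//; apply: (@le_lt_trans _ _ (B / d)).
    by rewrite ler_wpM2r// invr_ge0 ltW.
  by apply: lt_le_trans (truncnS_gt _) _; rewrite ler_nat ltnS.
rewrite ltr_norml => /andP[h1 _].
have := dotp_le_enorm (l - v k) (y - x); rewrite dotpDl dotpNl (enormBC l) => h2.
have h3 : enorm (v k - l) * enorm (y - x) <= enorm (v k - l).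
  by rewrite ler_piMr// enorm_ge0.
lra.
Qed.

Lemma proximal_step f (lam : R) x :
  convex_fun f -> continuous f -> argmin f !=set0 -> 0 < lam ->
  exists p, subdiff f p (lam^-1 *: (x - p)).
Proof.
move=> cf ctf [q qmin] l0.
(* Outside the ball of radius [rho] the quadratic term alone exceeds [f x - f q], so a minimizer
   over the ball is global. *)
pose rho := Num.sqrt (2 * lam * (f x - f q)).
have rho2 : rho ^+ 2 = 2 * lam * (f x - f q).
  by rewrite sqr_sqrtr// mulr_ge0 ?subr_ge0 ?qmin//; lra.
have [|p px pP] := @eball_min R n
  (fun y => f y + enorm (y - x) ^+ 2 / (2 * lam)) x rho _ (sqrtr_ge0 _).
  exact: proximal_objective_continuous.
exists p => y; apply: (@proximal_optimality f setT) => // z _.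
have [zx|zx] := leP (enorm (z - x)) rho; first exact: pP.
have := pP x; rewrite /eball/= subrr enorm0 sqrtr_ge0 => /(_ isT) /le_trans; apply.
rewrite expr0n/= mul0r addr0 -lerBlDl.
apply: (@le_trans _ _ (f x - f q)); first by rewrite lerB.
rewrite ler_pdivlMr; last lra.
rewrite mulrC -rho2 ler_pXn2r ?nnegrE ?enorm_ge0 ?sqrtr_ge0//; exact: ltW.
Qed.

Lemma slope_le f x v : subdiff f x v -> slope f x <= enorm v.
Proof.
by move=> vf; apply: ge_inf; [exists 0 => _ [u _ <-]; exact: enorm_ge0|exists v].
Qed.

Lemma le_slope f x (a : R) : convex_fun f -> continuous f ->
  (forall v, subdiff f x v -> a <= enorm v) -> a <= slope f x.
Proof.
move=> cf ctf h; have [v vf] := subdiff_nonempty x cf ctf.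
by apply: lb_le_inf => [|_ [w wf <-]]; [exists (enorm v), v|exact: h].
Qed.

Lemma slope_ge0 f x : convex_fun f -> continuous f -> 0 <= slope f x.
Proof. by move=> cf ctf; apply: le_slope => // v _; exact: enorm_ge0. Qed.

Lemma drop_le_slope g x y : convex_fun g -> continuous g ->
  g x - g y <= slope g x * enorm (x - y).
Proof.
move=> cg ctg; have [/enorm_eq0/eqP|xy] := eqVneq (enorm (x - y)) 0.
  by rewrite subr_eq0 => /eqP ->; rewrite !subrr enorm0 mulr0.
have xy0 : 0 < enorm (x - y) by rewrite lt_def xy enorm_ge0.
rewrite -ler_pdivrMr//; apply: le_slope => // v /(_ y).
rewrite ler_pdivrMr// -(opprB x y) dotpNr.
by have := dotp_le_enorm v (x - y); lra.
Qed.

End Subgradients.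

(** * Iterated proximal steps: contraction, slope estimates, cluster points *)

Section ProximalSequence.
Variables (R : realType) (n : nat) (f g : 'rV[R]_n -> R) (lam : R).
Variable x : nat -> 'rV[R]_n.
Hypotheses (cf : convex_fun f) (ctf : continuous f) (lam_gt0 : 0 < lam).
Hypotheses (cg : convex_fun g) (ctg : continuous g).
Hypothesis xP : forall k, subdiff f (x k.+1) (lam^-1 *: (x k - x k.+1)).

Lemma proximal_subgradient k y :
  dotp (x k - x k.+1) (y - x k.+1) <= lam * (f y - f (x k.+1)).
Proof. by have := xP k y; rewrite dotpZl ler_pdivrMl. Qed.

(** Expand the square of x k - y = (x k - x k.+1) - (y - x k.+1) and bound the cross term by the
    subgradient inequality. It is applied with [y] a minimizer, [x k] itself or a later iterate. *)
Lemma proximal_sqr_dist k y :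
  enorm (x k.+1 - y) ^+ 2 + 2 * lam * (f (x k.+1) - f y) <= enorm (x k - y) ^+ 2.
Proof.
have := proximal_subgradient k y.
have -> : x k - y = (x k - x k.+1) - (y - x k.+1) by rewrite opprB addrA subrK.
rewrite (enormBC (x k.+1)) !sqr_enorm.
move: (x k - x k.+1) (y - x k.+1) => u w.
by rewrite !dotpE (dotpC w u); have := dotp_ge0 u; lra.
Qed.

Lemma proximal_decrease : {homo x : i j / (i <= j)%N >-> f j <= f i}.
Proof.
apply: (@homo_leq _ x (fun y z => f z <= f y)) => [//|y u v h1 h2|k].
  exact: le_trans h2 h1.
have := proximal_sqr_dist k (x k).
rewrite subrr enorm0 expr0n/= -subr_ge0 => h.
have := sqr_ge0 (enorm (x k.+1 - x k)) => h'.
by rewrite -subr_ge0 -(pmulr_rge0 _ lam_gt0); lra.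
Qed.

(** As long as [f] stays above [f y], no step increases the distance to [y]. This serves both for
    minimizers and for later iterates. *)
Lemma proximal_dist_le i j y : (i <= j)%N -> f y <= f (x j) ->
  enorm (x j - y) <= enorm (x i - y).
Proof.
move=> /subnK <-; elim: (j - i)%N => [//|m IH]; rewrite addSn => fy.
apply: le_trans (IH _); last first.
  exact: le_trans fy (proximal_decrease (leqnSn _)).
rewrite -(@ler_pXn2r _ 2)// ?nnegrE ?enorm_ge0//.
apply: le_trans (proximal_sqr_dist _ y); rewrite lerDl.
by rewrite !mulr_ge0 ?subr_ge0 ?ler0n ?(ltW lam_gt0).
Qed.

Lemma proximal_self_contracted i j k : (i <= j <= k)%N ->
  enorm (x j - x k) <= enorm (x i - x k).
Proof.
by move=> /andP[ij jk]; apply: proximal_dist_le => //; exact: proximal_decrease.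
Qed.

(** Keeps the whole sequence in the neighbourhood of [argmin f] where the slope gap is
    controlled. *)
Lemma proximal_dist_set k : argmin f !=set0 ->
  dist_set (x k) (argmin f) <= dist_set (x 0%N) (argmin f).
Proof.
move=> [q0 q0P]; apply: lb_le_inf => [|_ [q qP <-]].
  by exists (enorm (x 0%N - q0)), q0.
apply: le_trans (proximal_dist_le (leq0n k) (qP _)); apply: ge_inf; last by exists q.
by exists 0 => _ [y _ <-]; exact: enorm_ge0.
Qed.

(** Sum [proximal_sqr_dist]; values decrease, so each of the N gaps is at least the last one, which
    is thus O(1/N). *)
Lemma proximal_rate q N : f q <= f (x N) ->
  enorm (x N - q) ^+ 2 + N%:R * (2 * lam * (f (x N) - f q)) <= enorm (x 0%N - q) ^+ 2.
Proof.
elim: N => [|N IH] qN; first by rewrite mul0r addr0.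
have fN := proximal_decrease (leqnSn N).
apply: le_trans (IH (le_trans qN fN)).
have := proximal_sqr_dist N q; rewrite -natr1 mulrDl mul1r.
have : N%:R * (2 * lam * (f (x N.+1) - f q)) <= N%:R * (2 * lam * (f (x N) - f q)).
  by rewrite ler_wpM2l// ler_pM2l ?lerD2r// mulr_gt0.
lra.
Qed.

(** Monotonicity of the subdifferential: any w in it at [x k] satisfies |u|^2 <= lam <w, u> for u =
    x k - x k.+1; Cauchy-Schwarz concludes. *)
Lemma proximal_step_le_slope k : enorm (x k.+1 - x k) <= lam * slope f (x k).
Proof.
rewrite -ler_pdivrMl//; apply: le_slope => // w wP.
have : dotp (x k - x k.+1) (x k - x k.+1) <= lam * dotp w (x k - x k.+1).
  have := wP (x k.+1); rewrite -(opprB (x k)) dotpNr -(ler_pM2l lam_gt0) => h.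
  by have := proximal_subgradient k (x k); lra.
rewrite (enormBC (x k.+1)) -sqr_enorm; move: (x k - x k.+1) => u h.
have [->|u0] := eqVneq (enorm u) 0; first by rewrite mulr0 enorm_ge0.
have {}u0 : 0 < enorm u by rewrite lt_def u0 enorm_ge0.
rewrite ler_pdivrMl// -(ler_pM2r u0) -expr2 -mulrA (le_trans h)//.
by rewrite ler_pM2l// dotp_le_enorm.
Qed.

Lemma proximal_slope_le_step k : lam * slope f (x k.+1) <= enorm (x k.+1 - x k).
Proof.
have := slope_le (xP k); rewrite enormZ gtr0_norm ?invr_gt0// (enormBC (x k.+1)).
by rewrite ler_pdivlMl.
Qed.

Lemma proximal_slope_decrease k : slope f (x k.+1) <= slope f (x k).
Proof.
rewrite -(ler_pM2l lam_gt0).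
exact: le_trans (proximal_slope_le_step k) (proximal_step_le_slope k).
Qed.

(* Each step loses at most [M] times its length, up to the decrease of the slope
   of [f] along the step; the latter telescopes, with a factor [lam]. *)
Lemma proximal_gap_le M N : (forall k, slope g (x k) - slope f (x k) <= M) ->
  g (x 0%N) - f (x 0%N) <= g (x N) - f (x N)
    + M * \sum_(i < N) enorm (x i.+1 - x i)
    + lam * slope f (x 0%N) * (slope f (x 0%N) - slope f (x N)).
Proof.
move=> hM; elim: N => [|N IH]; first by rewrite big_ord0 subrr !mulr0 !addr0.
apply: le_trans IH _; rewrite big_ord_recr/=.
have sl : slope f (x N) <= slope f (x 0%N).
  elim: N => [//|k IH]; exact: le_trans (proximal_slope_decrease k) IH.
have h1 := drop_le_slope (x N) (x N.+1) cg ctg.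
(* The drop of [g] involves the slope at the start of the step, that of [f] the slope at its end;
   [h4] bounds the mismatch. *)
have h2 : slope f (x N.+1) * enorm (x N.+1 - x N) <= f (x N) - f (x N.+1).
  have := proximal_subgradient N (x N); rewrite -sqr_enorm expr2 (enormBC (x N)) => h.
  rewrite -(ler_pM2l lam_gt0); apply: le_trans h; rewrite mulrA.
  by rewrite ler_wpM2r ?enorm_ge0// proximal_slope_le_step.
rewrite (enormBC (x N)) in h1.
have s0 := enorm_ge0 (x N.+1 - x N).
have h3 := ler_wpM2r s0 (hM N).
have h4 : (slope f (x N) - slope f (x N.+1)) * enorm (x N.+1 - x N) <=
    (slope f (x N) - slope f (x N.+1)) * (lam * slope f (x 0%N)).
  rewrite ler_wpM2l ?subr_ge0 ?proximal_slope_decrease//.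
  by rewrite (le_trans (proximal_step_le_slope N))// ler_pM2l.
lra.
Qed.

(** The sequence is bounded, so it clusters at some [l]; the rate and continuity of [f] make [l] a
    minimizer, and continuity of g - f yields the index. *)
Lemma proximal_cluster_argmin q e : argmin f q -> 0 < e ->
  exists l N, argmin f l /\ g (x N) - f (x N) <= g l - f l + e.
Proof.
move=> qP e0.
have [|l lP] := @bounded_seq_cluster R n x q (enorm (x 0%N - q)).
  by move=> k; apply: proximal_dist_le => //; exact: qP.
have lmin : argmin f l.
  suff lq : f l <= f q by move=> y; exact: le_trans lq (qP y).
  apply/ler_addgt0Pr => d d0; have d2 : 0 < d / 2 by lra.
  have [c c0 cP] := @continuous_enormP R n f l _ ctf d2.
  pose B := enorm (x 0%N - q) ^+ 2 / (lam * d).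
  have ld0 : 0 < lam * d by rewrite mulr_gt0.
  have [k Nk /cP] := lP c (Num.truncn B).+1 c0.
  rewrite ltr_norml => /andP[h1 _].
  have kB : enorm (x 0%N - q) ^+ 2 <= k%:R * (lam * d).
    rewrite -ler_pdivrMr// -/B; apply: ltW; apply: lt_le_trans (truncnS_gt _) _.
    by rewrite ler_nat.
  have k0 : (0 : R) < k%:R by rewrite ltr0n (leq_trans _ Nk).
  have := proximal_rate (qP (x k)); have := sqr_ge0 (enorm (x k - q)) => h2 h3.
  have : k%:R * (2 * lam * (f (x k) - f q)) <= k%:R * (lam * d) by lra.
  rewrite ler_pM2l// mulrAC (mulrC _ lam) ler_pM2l//; lra.
have ch : continuous (fun y => g y - f y).
  by move=> y; apply: (@continuousB _ _ _ g f); [exact: ctg|exact: ctf].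
have [c c0 cP] := @continuous_enormP R n _ l _ ch e0.
have [k _ /cP] := lP c 0%N c0; rewrite ltr_norml => /andP[_ h].
by exists l, k; split=> //; lra.
Qed.

End ProximalSequence.

(** * The gap bound with real bounds [M], [P] and the distance to one minimizer *)

Lemma gap_le_of_slope_gap (R : realType) (n : nat) : exists2 K : R, 0 < K &
  forall (f g : 'rV[R]_n -> R) (r M P : R) x q,
    convex_fun f -> convex_fun g -> continuous f -> continuous g -> 0 <= M ->
    (forall y, dist_set y (argmin f) <= r -> slope g y - slope f y <= M) ->
    (forall y, argmin f y -> g y - f y <= P) ->
    dist_set x (argmin f) <= r -> argmin f q ->
    g x - f x <= K * M * enorm (x - q) + P.
Proof.
have [K K0 len] := self_contracted_length R n.
(* The sequence stays within 2 |x - q| of its start, hence the factor 2. *)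
exists (K * 2) => [|f g r M P x q cf cg ctf ctg M0 hM hP xr qP]; first lra.
have f0 : argmin f !=set0 by exists q.
set a := slope f x; have a0 : 0 <= a by exact: slope_ge0.
(* Chosen so that lam a^2 <= e / 2, the [+ 1] covering a = 0; the approach to the cluster point uses
   the other e / 2. *)
apply/ler_addgt0Pr => e e0; pose lam := e / 2 / (a ^+ 2 + 1).
have a1 : 0 < a ^+ 2 + 1 by rewrite ltr_wpDl ?sqr_ge0.
have l0 : 0 < lam by rewrite !divr_gt0.
have la : lam * a * a <= e / 2.
  rewrite -mulrA -expr2 /lam mulrAC ler_pdivrMr// ler_pM2l; last lra.
  lra.
have /choice[prox proxP] := fun y => proximal_step y cf ctf f0 l0.
pose s k := iter k prox x.
have sP k : subdiff f (s k.+1) (lam^-1 *: (s k - s k.+1)) by exact: proxP.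
have e2 : 0 < e / 2 by lra.
have [l [N [lmin hN]]] := proximal_cluster_argmin ctf l0 ctg sP qP e2.
have hMs k : slope g (s k) - slope f (s k) <= M.
  by apply: hM; exact: le_trans (proximal_dist_set l0 sP k f0) xr.
have sD k : enorm (s k - s 0%N) <= 2 * enorm (x - q).
  apply: le_trans (enormB_le q _ _) _; rewrite (enormBC q).
  have := proximal_dist_le l0 sP (leq0n k) (qP (s k)); rewrite -/(s 0%N) => h.
  by rewrite mulr_natl mulr2n lerD2r.
have := ler_wpM2l M0 (len s _ (proximal_self_contracted l0 sP) sD N).
have := proximal_gap_le cf ctf l0 cg ctg sP N hMs; rewrite -/x -/a.
have : lam * a * (a - slope f (s N)) <= lam * a * a.
  have la0 : 0 <= lam * a by exact: mulr_ge0 (ltW l0) a0.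
  by apply: ler_wpM2l => //; rewrite gerBl; exact: slope_ge0.
have := hP l lmin.
rewrite /=; lra.
Qed.

(** * Extended-real suprema and passage to the distance *)

Section PositiveSup.
Variables (R : realType) (n : nat).
Implicit Types (w : 'rV[R]_n -> R) (U : set 'rV[R]_n).

Lemma possup_ge0 w U : U !=set0 -> (0 <= possup w U)%E.
Proof.
move=> [x Ux]; apply: (@le_trans _ _ (Num.max (w x) 0)%:E).
  by rewrite lee_fin le_max lexx orbT.
by apply: ereal_sup_ubound; exists x.
Qed.

Lemma le_possup w U x : U x -> ((w x)%:E <= possup w U)%E.
Proof.
move=> Ux; apply: (@le_trans _ _ (Num.max (w x) 0)%:E).
  by rewrite lee_fin le_max lexx.
by apply: ereal_sup_ubound; exists x.
Qed.

Lemma dist_set_ge0 (x : 'rV[R]_n) U : U !=set0 -> 0 <= dist_set x U.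
Proof.
move=> [y Uy]; apply: lb_le_inf; first by exists (enorm (x - y)), y.
by move=> _ [z _ <-]; exact: enorm_ge0.
Qed.

(** [argmin f] is closed; this settles an infinite supremum multiplied by a zero distance. *)
Lemma argmin_of_dist0 (f : 'rV[R]_n -> R) x : continuous f -> argmin f !=set0 ->
  dist_set x (argmin f) = 0 -> argmin f x.
Proof.
move=> ctf [q0 q0P] d0 y; apply/ler_addgt0Pr => e e0.
have [c c0 cP] := continuous_enormP x ctf e0.
have [||_ [q qP <-] xq] := @inf_lt R [set enorm (x - z) | z in argmin f] c.
- by exists (enorm (x - q0)), q0.
- by move: d0; rewrite /dist_set => ->.
have := cP q; rewrite enormBC xq ltr_norml => /(_ isT)/andP[h _].
by have := qP y; lra.
Qed.

End PositiveSup.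

Theorem theorem1 (R : realType) (n : nat) (hn : (1 <= n)%N) :
  exists K : R, 0 < K /\
  forall (f g : 'rV[R]_n -> R),
    convex_fun f -> convex_fun g -> continuous f -> continuous g ->
    argmin f !=set0 ->
    forall r : R, 0 < r ->
    forall x : 'rV[R]_n, dist_set x (argmin f) <= r ->
      ((g x - f x)%R%:E <=
        K%:E * possup (fun y => (slope g y - slope f y)%R)
                      [set y | (dist_set y (argmin f) <= r)%R]
          * (dist_set x (argmin f))%:E
        + possup (fun y => (g y - f y)%R) (argmin f))%E.
Proof.
have [K K0 gap] := gap_le_of_slope_gap R n.
exists K; split=> // f g cf cg ctf ctg f0 r r0 x xr.
set U := [set y | _]; set S := possup _ U; set Q := possup _ (argmin f).
have Sge0 : (0 <= S)%E by apply: possup_ge0; exists x.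
have Qge0 : (0 <= Q)%E by exact: possup_ge0.
have d0 := dist_set_ge0 x f0.
have prod0 : (0 <= K%:E * S * (dist_set x (argmin f))%:E)%E.
  by rewrite !mule_ge0// lee_fin// ltW.
have hQ y : argmin f y -> ((g y - f y)%:E <= Q)%E.
  exact: (@le_possup _ _ (fun y => g y - f y)).
have hS y : U y -> ((slope g y - slope f y)%:E <= S)%E.
  exact: (@le_possup _ _ (fun y => slope g y - slope f y)).
case: Q Qge0 hQ => [P|_ _|//]; last first.
  by rewrite addey ?leey// gt_eqF// (lt_le_trans _ prod0).
(* For infinite [S], a zero distance makes the product 0 by convention and [x] a minimizer; a
   positive distance makes the right side infinite. *)
move=> _ hQ; case: S Sge0 hS prod0 => [M|_ _|//]; last first.
  have [xd _|xd _] := eqVneq (dist_set x (argmin f)) 0.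
    rewrite xd mule0 add0e; apply: hQ; exact: argmin_of_dist0.
  rewrite gt0_muley ?lte_fin// gt0_mulye ?lte_fin ?lt_def ?xd//.
  by rewrite addye ?leey.
rewrite lee_fin => M0 hS _; rewrite -!EFinM -EFinD lee_fin.
have {}gap q : argmin f q -> g x - f x - P <= K * M * enorm (x - q).
  move=> qP; rewrite lerBlDr; apply: (gap f g r) => //.
(* Dividing by [K * M] turns the bounds for all [q] into one on the infimum defining the distance,
   so a zero factor is treated apart. *)
have [KM0|KM0] := eqVneq (K * M) 0.
  by have [q /gap] := f0; rewrite KM0 !mul0r add0r subr_le0.
have {}KM0 : 0 < K * M by rewrite lt_def KM0 mulr_ge0// ltW.
rewrite -lerBlDr -ler_pdivrMl//; apply: lb_le_inf.
  by have [q qP] := f0; exists (enorm (x - q)), q.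
by move=> _ [q qP <-]; rewrite ler_pdivrMl//; exact: gap.
Qed.
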